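(* Let $m\ge p\ge 1$, let $\Psi:\mathbb{R}^m\to\mathbb{R}^p$ be a real polynomial map and let $V:=\Psi^{-1}(0)$. Suppose that $\Psi$ is radial weighted-homogeneous and that $\mathrm{Sing}\,\Psi\subset V$. Then $M\left(\frac{\Psi}{\|\Psi\|}\right)$ is bounded.
   Context: Radial weighted-homogeneous: there are relatively prime positive integers $q_1,\ldots,q_m$ and an integer $d$ such that, for the action $\rho\cdot x=(\rho^{q_1}x_1,\ldots,\rho^{q_m}x_m)$ of $\mathbb{R}_+$ (positive reals) on $\mathbb{R}^m$, one has $\Psi(\rho\cdot x)=\rho^d\,\Psi(x)$ for all $x\in\mathbb{R}^m$ and all $\rho\in\mathbb{R}_+$. $\mathrm{Sing}\,\Psi$ is the set of points where the differential of $\Psi$ has rank $<p$. $M(\Psi/\|\Psi\|)\subset\mathbb{R}^m\setminus V$ is the set of points $x\in\mathbb{R}^m\setminus V$ at which the Euclidean distance function and $\Psi/\|\Psi\|$ are not transversal, i.e. at which $(\|x\|^2,\Psi/\|\Psi\|):\mathbb{R}^m\setminus V\to\mathbb{R}\times S^{p-1}_1$ is not a submersion, where $S^{p-1}_1$ is the unit sphere of $\mathbb{R}^p$. *)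

(* Defs.v *)
From mathcomp Require Import all_boot all_order all_algebra.
From mathcomp Require Import all_classical all_reals all_analysis.
From mathcomp Require mpoly.
Import Order.TTheory GRing.Theory Num.Theory.
Import numFieldNormedType.Exports.

Set Implicit Arguments.
Unset Strict Implicit.
Unset Printing Implicit Defensive.

Local Open Scope classical_set_scope.
Local Open Scope ring_scope.

(* R^n is 'rV[R]_n.  The library norm `|x| on 'rV[R]_n is the sup norm: it
   induces the same topology, differentials and bounded sets as the Euclidean
   norm, but the Euclidean norm has to be defined separately. *)

Definition dotprod (R : realType) (n : nat) (x y : 'rV[R]_n) : R :=
  \sum_(i < n) x 0 i * y 0 i.

Definition enorm (R : realType) (n : nat) (x : 'rV[R]_n) : R :=
  Num.sqrt (dotprod x x).

Definition usphere (R : realType) (n : nat) : set 'rV[R]_n :=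
  [set y | enorm y = 1].

Definition tangent_usphere (R : realType) (n : nat) (y : 'rV[R]_n) :
    set 'rV[R]_n :=
  [set w | dotprod y w = 0].

Definition polynomial_map (R : realType) (m p : nat)
    (Psi : 'rV[R]_m -> 'rV[R]_p) : Prop :=
  forall i : 'I_p, exists P : mpoly.mpoly m R,
    forall x : 'rV[R]_m, Psi x 0 i = mpoly.meval (fun j => x 0 j) P.

Definition zero_locus (R : realType) (m p : nat)
    (Psi : 'rV[R]_m -> 'rV[R]_p) : set 'rV[R]_m :=
  Psi @^-1` [set 0].

(* 'J Psi x is the m x p matrix of 'd Psi x acting on row vectors. *)
Definition Sing (R : realType) (m p : nat)
    (Psi : 'rV[R]_m -> 'rV[R]_p) : set 'rV[R]_m :=
  [set x | (\rank ('J Psi x) < p)%N].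

Definition weighted_action (R : realType) (m : nat) (q : 'I_m -> nat)
    (rho : R) (x : 'rV[R]_m) : 'rV[R]_m :=
  \row_i (rho ^+ q i * x 0 i).

(* Relatively prime means that the greatest common divisor of all the weights
   is 1 (setwise, not pairwise); the degree d may be any integer. *)
Definition radial_weighted_homogeneous (R : realType) (m p : nat)
    (Psi : 'rV[R]_m -> 'rV[R]_p) : Prop :=
  exists (q : 'I_m -> nat) (d : int),
    [/\ forall i, (0 < q i)%N,
        \big[gcdn/0%N]_(i < m) q i = 1%N
      & forall (x : 'rV[R]_m) (rho : R), 0 < rho ->
          Psi (weighted_action q rho x) = rho ^ d *: Psi x].

(* Psi / ||Psi||; only meaningful off the zero locus, which is closed when Psi
   is continuous, so that differentials at points off the zero locus do not
   depend on the values taken on it. *)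
Definition normalized (R : realType) (m p : nat)
    (Psi : 'rV[R]_m -> 'rV[R]_p) (x : 'rV[R]_m) : 'rV[R]_p :=
  (enorm (Psi x))^-1 *: Psi x.

(* x |-> (||x||^2, Psi x / ||Psi x||). *)
Definition dist_normalized (R : realType) (m p : nat)
    (Psi : 'rV[R]_m -> 'rV[R]_p) (x : 'rV[R]_m) : R^o * 'rV[R]_p :=
  (enorm x ^+ 2, normalized Psi x).

(* A map f into R x S^{p-1}, viewed as a map into R x R^p, is a submersion at x
   when its differential at x maps onto the tangent space of R x S^{p-1} at
   f x. *)
Definition submersion_at (R : realType) (m p : nat)
    (f : 'rV[R]_m -> R^o * 'rV[R]_p) (x : 'rV[R]_m) : Prop :=
  [/\ usphere (f x).2,
      differentiable f x
    & range ('d f x) = [set: R^o] `*` tangent_usphere (f x).2].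

Definition Milnor_set_normalized (R : realType) (m p : nat)
    (Psi : 'rV[R]_m -> 'rV[R]_p) : set 'rV[R]_m :=
  [set x | ~ zero_locus Psi x /\ ~ submersion_at (dist_normalized Psi) x].

(* Main.v *)
(** Off the zero locus, [normalized Psi] is constant on the orbits of the
    weighted action, so its differential kills the Euler field
    [gamma = (q_i x_i)_i], whereas the differential of [||x||^2] along [gamma]
    is [2 \sum_i q_i x_i^2 > 0] as soon as [x != 0].  As [Psi] is a submersion
    off its zero locus, [normalized Psi] is a submersion onto the sphere there,
    and [gamma] supplies the missing radial direction.  Hence the Milnor set is
    contained in [{0}]. *)
From HB Require Import structures.
Require Import Defs.
From mathcomp Require Import all_boot all_order all_algebra.
From mathcomp Require Import all_classical all_reals all_analysis.
From mathcomp Require mpoly.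
Import Order.TTheory GRing.Theory Num.Theory.
Import numFieldNormedType.Exports.
Local Open Scope classical_set_scope.
Local Open Scope ring_scope.

Set Implicit Arguments.
Unset Strict Implicit.
Unset Printing Implicit Defensive.

(** * Euclidean inner product and norm *)

Section Dotprod.
Context {R : realType} {n : nat}.
Implicit Types (x y z : 'rV[R]_n) (c : R).

Lemma dotprodC x y : dotprod x y = dotprod y x.
Proof. by apply: eq_bigr => i _; rewrite mulrC. Qed.

Lemma dotprodDr x y z : dotprod x (y + z) = dotprod x y + dotprod x z.
Proof.
by rewrite /dotprod -big_split; apply: eq_bigr => i _; rewrite mxE mulrDr.
Qed.

Lemma dotprodZr c x y : dotprod x (c *: y) = c * dotprod x y.
Proof.
by rewrite /dotprod big_distrr; apply: eq_bigr => i _; rewrite mxE mulrCA.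
Qed.

Lemma dotprodZl c x y : dotprod (c *: x) y = c * dotprod x y.
Proof. by rewrite dotprodC dotprodZr dotprodC. Qed.

Lemma dotprod_ge0 x : 0 <= dotprod x x.
Proof. by apply: sumr_ge0 => i _; rewrite -expr2 sqr_ge0. Qed.

Lemma dotprod_gt0 x : x != 0 -> 0 < dotprod x x.
Proof.
rewrite lt0r dotprod_ge0 andbT; apply: contraNneq => x0.
have /psumr_eq0P : forall i : 'I_n, true -> 0 <= x 0 i * x 0 i.
  by move=> i _; rewrite -expr2 sqr_ge0.
move=> /(_ x0) xi0; apply/eqP/rowP => i; rewrite mxE.
by apply/eqP; rewrite -sqrf_eq0 expr2 xi0.
Qed.

Lemma sqr_enorm x : enorm x ^+ 2 = dotprod x x.
Proof. by rewrite sqr_sqrtr // dotprod_ge0. Qed.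

Lemma enorm_gt0 x : x != 0 -> 0 < enorm x.
Proof. by move=> x0; rewrite sqrtr_gt0 dotprod_gt0. Qed.

Lemma enormZ c x : enorm (c *: x) = `|c| * enorm x.
Proof.
by rewrite /enorm dotprodZl dotprodZr mulrA -expr2 sqrtrM ?sqr_ge0// sqrtr_sqr.
Qed.

End Dotprod.

(** * Differentials of coordinates, inner products and norms *)

Section Differentiability.
Context {R : realType} {V : normedModType R}.

Lemma is_diff_sum (W : normedModType R) (n : nat) (f df : 'I_n -> V -> W)
    (x : V) :
  (forall i, is_diff x (f i) (df i)) ->
  is_diff x (\sum_(i < n) f i) (\sum_(i < n) df i).
Proof.
move=> fdf; elim/big_ind2: _ => //.
- exact: is_diff_cst.
- by move=> *; apply: is_diffD.
Qed.

Lemma is_diff_coord (m n : nat) (f : V -> 'M[R]_(m, n)) (x : V) i j :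
  differentiable f x ->
  is_diff x (fun y => f y i j : R) (fun v => 'd f x v i j).
Proof.
have lin_coord : linear (fun M : 'M[R]_(m, n) => M i j : R).
  by move=> c M N; rewrite !mxE.
(* Packing the coordinate as a linear map lets [diff_lin] identify it with its own differential. *)
pose coordM := GRing.isLinear.Build _ _ _ _ _ lin_coord.
pose coordL : {linear _ -> _} := HB.pack (fun M : 'M[R]_(m, n) => M i j : R) coordM.
move=> dfx; have dcoord : differentiable coordL (f x).
  exact: differentiable_coord.
apply: DiffDef; first exact: (differentiable_comp dfx dcoord).
rewrite [LHS](diff_comp dfx dcoord) diff_lin //.
exact: coord_continuous.
Qed.

Lemma differentiable_rV (n : nat) (f : V -> 'rV[R]_n) (x : V) :
  (forall i, differentiable (fun y => f y 0 i : R) x) -> differentiable f x.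
Proof.
move=> df; have -> : f = \sum_(i < n) (fun y => f y 0 i *: delta_mx 0 i).
  by apply/funext => y; rewrite fct_sumE [LHS]row_sum_delta.
by apply: differentiable_sum => i; apply: differentiableZl.
Qed.

Lemma is_diff_dotprod (n : nat) (f g : V -> 'rV[R]_n) (x : V) :
  differentiable f x -> differentiable g x ->
  is_diff x (fun y => dotprod (f y) (g y) : R)
    (fun v => dotprod (f x) ('d g x v) + dotprod (g x) ('d f x v)).
Proof.
move=> df dg.
have -> : (fun y => dotprod (f y) (g y)) =
    \sum_(i < n) ((fun y => f y 0 i : R) * (fun y => g y 0 i : R)).
  by apply/funext => y; rewrite fct_sumE.
have -> : (fun v => dotprod (f x) ('d g x v) + dotprod (g x) ('d f x v)) =
    \sum_(i < n) (f x 0 i *: (fun v => 'd g x v 0 i : R) +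
                  g x 0 i *: (fun v => 'd f x v 0 i : R)).
  by apply/funext => v; rewrite fct_sumE /dotprod -big_split.
by apply: is_diff_sum => i; apply: is_diffM; exact: is_diff_coord.
Qed.

(** Chain rule through the square root, which is differentiable only at positive arguments; hence
    the condition [f x != 0]. *)
Lemma differentiable_enorm (n : nat) (f : V -> 'rV[R]_n) (x : V) :
  differentiable f x -> f x != 0 ->
  differentiable (fun y => enorm (f y) : R) x.
Proof.
move=> df fx0; have [dff _] := is_diff_dotprod df df.
apply: (differentiable_comp dff); apply/derivable1_diffP.
by have [] := is_derive1_sqrt (dotprod_gt0 fx0).
Qed.

End Differentiability.

(** * The normalized map and its differential *)

Section Normalized.
Context {R : realType} {m p : nat}.
Implicit Types (Psi : 'rV[R]_m -> 'rV[R]_p) (x : 'rV[R]_m).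

Lemma differentiable_polynomial_map Psi x :
  polynomial_map Psi -> differentiable Psi x.
Proof.
move=> Ppol; apply: differentiable_rV => i; have [P PE] := Ppol i.
under eq_fun do rewrite PE.
elim/mpoly.mpolyind: P {PE} => [|c e P _ _ IH].
  by under eq_fun do rewrite mpoly.meval0.
under eq_fun do rewrite mpoly.mevalD mpoly.mevalZ mpoly.mevalX.
apply: differentiableD => //; apply: differentiableZ.
(* Generalizing the index list turns the monomial into a product over an arbitrary list, open to
   induction. *)
elim: (index_enum _) => [|j s IHs]; first by under eq_fun do rewrite big_nil.
under eq_fun do rewrite big_cons; apply: differentiableM => //.
apply: (differentiable_comp (g := fun r : R => r ^+ mpoly.fun_of_multinom e j)).
  exact: differentiable_coord.
by apply/derivable1_diffP/exprn_derivable.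
Qed.

Lemma enorm_normalized Psi x : Psi x != 0 -> enorm (normalized Psi x) = 1.
Proof.
move=> /enorm_gt0 Px0.
by rewrite enormZ gtr0_norm ?invr_gt0// mulVf// gt_eqF.
Qed.

Lemma differentiable_normalized Psi x : Psi x != 0 ->
  differentiable Psi x -> differentiable (normalized Psi) x.
Proof.
move=> Px0 dPsi; apply: differentiable_rV => i.
under eq_fun do rewrite mxE.
apply: differentiableM.
  by apply: differentiableV; [exact: differentiable_enorm
    | rewrite gt_eqF// enorm_gt0].
by have [] := is_diff_coord 0 i dPsi.
Qed.

(** Differentiate the identity [dotprod N N = 1] for [N := normalized Psi]: it holds on a
    neighbourhood of [x], because [Psi] is continuous and nonzero at [x]. *)
Lemma diff_normalized_tangent Psi x v : Psi x != 0 ->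
  (forall y, differentiable Psi y) ->
  dotprod (normalized Psi x) ('d (normalized Psi) x v) = 0.
Proof.
move=> Px0 dPsi.
have dN := differentiable_normalized Px0 (dPsi x).
have [dNN dNNE] := is_diff_dotprod dN dN.
have : 'D_v (fun y => dotprod (normalized Psi y) (normalized Psi y) : R) x = 0.
  rewrite -(derive_cst (1 : R) x v); apply: near_eq_derive.
  near=> y; rewrite /cst -sqr_enorm enorm_normalized ?expr1n//.
  near: y; apply: (cvgr_neq0 (Psi x)) => //.
  exact: differentiable_continuous.
rewrite deriveE// dNNE -mulr2n => /eqP.
by rewrite mulrn_eq0 => /eqP.
Unshelve. all: by end_near. Qed.

(** Leibniz rule, with [c] the derivative of the inverse norm along [v]. Its value can stay hidden:
    tangency to the sphere will determine the component along [Psi x]. *)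
Lemma diff_normalizedE Psi x v : Psi x != 0 -> differentiable Psi x ->
  exists c : R, 'd (normalized Psi) x v =
    (enorm (Psi x))^-1 *: 'd Psi x v + c *: Psi x.
Proof.
move=> Px0 dPsi; pose k (y : 'rV[R]_m) : R := (enorm (Psi y))^-1.
have dk : differentiable k x.
  by apply: differentiableV; [exact: differentiable_enorm
    | rewrite gt_eqF// enorm_gt0].
exists ('d k x v); apply/rowP => i.
have [_ dNE] := is_diff_coord 0 i (differentiable_normalized Px0 dPsi).
have dPi := is_diff_coord 0 i dPsi.
transitivity ('d (fun y => normalized Psi y 0 i : R) x v); first by rewrite dNE.
have -> : (fun y => normalized Psi y 0 i : R) = k * (fun y => Psi y 0 i).
  by apply/funext => y; rewrite mxE.
have [_ ->] := is_diffM (differentiableP dk) dPi.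
by rewrite !mxE /= [RHS]addrC mulrC addrC.
Qed.

(** Lift a multiple of [w] through the full-rank Jacobian. The image under the differential of
    [normalized Psi] is then [w] plus a multiple of [Psi x]; as the image and [w] are both
    orthogonal to [Psi x], that multiple vanishes. *)
Lemma diff_normalized_surj Psi x w : Psi x != 0 ->
  (forall y, differentiable Psi y) -> ~ Sing Psi x ->
  dotprod (normalized Psi x) w = 0 ->
  exists v, 'd (normalized Psi) x v = w.
Proof.
move=> Px0 dPsi /negP; rewrite -leqNgt => rkJ wtan.
have e0 := enorm_gt0 Px0.
(* The factor [enorm (Psi x)] compensates the inverse norm in [diff_normalizedE]. *)
have [v vE] : exists v, 'd Psi x v = enorm (Psi x) *: w.
  have /submxP[v vE] : (enorm (Psi x) *: w <= 'J Psi x)%MS.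
    by apply: submx_full; rewrite /row_full eqn_leq rank_leq_col.
  by exists v; rewrite vE mul_rV_lin1.
exists v; have [c cE] := diff_normalizedE v Px0 (dPsi x).
have := diff_normalized_tangent v Px0 dPsi.
rewrite cE vE scalerA mulVf ?gt_eqF// scale1r dotprodDr wtan add0r.
rewrite dotprodZr dotprodZl => /eqP; rewrite !mulf_eq0 invr_eq0.
rewrite (gt_eqF e0) (gt_eqF (dotprod_gt0 Px0)) !orbF => /eqP ->.
by rewrite scale0r addr0.
Qed.

(** * Weighted action and its Euler field *)

Lemma normalized_weighted_action (q : 'I_m -> nat) (d : int) Psi x rho :
  (forall y (r : R), 0 < r -> Psi (weighted_action q r y) = r ^ d *: Psi y) ->
  0 < rho -> normalized Psi (weighted_action q rho x) = normalized Psi x.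
Proof.
move=> Phom rho0; have c0 : 0 < rho ^ d by exact: exprz_gt0.
rewrite /normalized Phom// enormZ gtr0_norm// scalerA invfM mulrAC.
by rewrite mulVf ?mul1r// gt_eqF.
Qed.

(** The infinitesimal generator of the weighted action: the velocity of the orbit of [x] at
    [rho = 1]. *)
Definition euler_field (q : 'I_m -> nat) x : 'rV[R]_m :=
  \row_i ((q i)%:R * x 0 i).

Lemma differentiable_weighted_action (q : 'I_m -> nat) x (rho : R) :
  differentiable (fun r : R => weighted_action q r x) rho.
Proof.
apply: differentiable_rV => i; under eq_fun do rewrite mxE.
by apply: differentiableM => //; apply/derivable1_diffP/exprn_derivable.
Qed.

Lemma diff_weighted_action (q : 'I_m -> nat) x :
  'd (fun r : R => weighted_action q r x) (1 : R) 1 = euler_field q x.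
Proof.
apply/rowP => i; rewrite mxE.
have dq := @differentiable_weighted_action q x 1.
have [_ dqE] := is_diff_coord 0 i dq.
transitivity ('d (fun r : R => weighted_action q r x 0 i : R) (1 : R) 1).
  by rewrite dqE.
under eq_fun do rewrite mxE.
have dX : differentiable (fun r : R => r ^+ q i) (1 : R).
  by apply/derivable1_diffP/exprn_derivable.
rewrite -deriveE; last exact: differentiableM.
rewrite deriveMr; last exact: exprn_derivable.
by rewrite exp_derive expr1n !scaler1 mulrC.
Qed.

Lemma diff_normalized_euler_field (q : 'I_m -> nat) (d : int) Psi x :
  (forall y (r : R), 0 < r -> Psi (weighted_action q r y) = r ^ d *: Psi y) ->
  Psi x != 0 -> differentiable Psi x ->
  'd (normalized Psi) x (euler_field q x) = 0.
Proof.
move=> Phom Px0 dPsi; pose g (r : R) := weighted_action q r x.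
have g1 : g 1 = x by apply/rowP => i; rewrite mxE expr1n mul1r.
have dg : differentiable g (1 : R) by exact: differentiable_weighted_action.
have dN : differentiable (normalized Psi) (g 1).
  by rewrite g1; exact: differentiable_normalized.
have : 'D_(1 : R) (normalized Psi \o g) (1 : R) = 0.
  rewrite -(derive_cst (normalized Psi x) (1 : R) (1 : R)).
  (* Homogeneity is available for [r > 0] only, so the orbit map is shown constant near 1, which
     suffices for the derivative there. *)
  apply: near_eq_derive; near=> r.
  rewrite /= (normalized_weighted_action _ Phom)//.
  by near: r; exact: lt_nbhsr.
rewrite deriveE; last exact: differentiable_comp.
by rewrite diff_comp//= diff_weighted_action g1.
Unshelve. all: by end_near. Qed.

(** Since every weight is at least 1, the sum dominates [dotprod x x] term by term. *)
Lemma dotprod_euler_field_gt0 (q : 'I_m -> nat) x :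
  (forall i, (0 < q i)%N) -> x != 0 -> 0 < dotprod x (euler_field q x).
Proof.
move=> q0 x0; apply: (lt_le_trans (dotprod_gt0 x0)).
apply: ler_sum => i _; rewrite mxE mulrCA ler_peMl ?ler1n//.
by rewrite -expr2 sqr_ge0.
Qed.

Lemma submersion_dist_normalized Psi x : polynomial_map Psi ->
  radial_weighted_homogeneous Psi -> Psi x != 0 -> ~ Sing Psi x -> x != 0 ->
  submersion_at (dist_normalized Psi) x.
Proof.
move=> Ppol [q [d [q0 _ Phom]]] Px0 regx x0.
have dPsi y : differentiable Psi y by exact: differentiable_polynomial_map.
have dN := differentiable_normalized Px0 (dPsi x).
pose sq (y : 'rV[R]_m) : R^o := enorm y ^+ 2.
have [dsq dsqE] : is_diff x sq (fun v => dotprod x v *+ 2).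
  have -> : sq = (fun y => dotprod y y : R).
    by apply/funext => y; rewrite /sq sqr_enorm.
  have did : differentiable (@id 'rV[R]_m) x by [].
  apply: (is_diff_eq (is_diff_dotprod did did)).
  by apply/funext => v; rewrite diff_val mulr2n.
have dE : 'd (dist_normalized Psi) x =
    (fun v => ('d sq x v, 'd (normalized Psi) x v)) :> (_ -> _).
  exact: (diff_pair dsq dN).
split; first exact: enorm_normalized.
  exact: (differentiable_pair dsq dN).
(* One inclusion is tangency; for the other, [v] reaches [w] and is then corrected along the Euler
   field to reach [a]. *)
rewrite dE; apply/seteqP; split => [_ [v _ <-]|[a w] [_ /= wtan]].
  by split => //=; exact: diff_normalized_tangent.
have [v vE] := diff_normalized_surj Px0 dPsi regx wtan.
have gamma0 := dotprod_euler_field_gt0 q0 x0.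
pose gamma := euler_field q x.
(* [t] solves [2 dotprod x (v + t gamma) = a]; moving along [gamma] leaves the spherical component
   equal to [w]. *)
pose t : R := (a - dotprod x v *+ 2) / (dotprod x gamma *+ 2).
exists (v + t *: gamma) => //; congr pair.
  rewrite dsqE dotprodDr dotprodZr mulrnDl -mulrnAr divfK ?subrKC//.
  by rewrite mulrn_eq0/= gt_eqF.
by rewrite linearD linearZ/= vE (diff_normalized_euler_field Phom)// scaler0 addr0.
Qed.

End Normalized.

Theorem proposition4p1 (R : realType) (m p : nat) (hp : (1 <= p)%N)
    (hpm : (p <= m)%N) (Psi : 'rV[R]_m -> 'rV[R]_p)
    (hpoly : polynomial_map Psi)
    (hhom : radial_weighted_homogeneous Psi)
    (hsing : Sing Psi `<=` zero_locus Psi) :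
  bounded_set (Milnor_set_normalized Psi).
Proof.
have M0 x : Milnor_set_normalized Psi x -> x = 0.
  move=> [Px0 nsub]; apply/eqP; apply: contra_notT nsub => x0.
  apply: submersion_dist_normalized => //; first exact/eqP.
  by move=> /hsing.
(* The Milnor set lies in the singleton of the origin, so every [r > 0] is a bound. *)
exists 0; split; first exact: real0.
by move=> r r0 x /M0 ->; rewrite /= normr0 ltW.
Qed.
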